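(* Let $A\in\mathcal{R}(\mathbb{T},\mathbb{H}^{n\times n})$ be a constant quaternion matrix and $t_0\in\mathbb{T}$. Suppose there exist quaternion constants $\alpha_1,\dots,\alpha_m\in\mathcal{R}(\mathbb{T},\mathbb{H})$ such that $P_m=0$, where $P_0,P_1,\dots,P_m$ are recursively defined by $P_0=I_n$ and $$P_k=AP_{k-1}-P_{k-1}\alpha_k=A^k+\sum_{j=1}^k(-1)^jA^{k-j}\sum_{1\le i_1<i_2<\dots<i_j\le k}\alpha_{i_1}\alpha_{i_2}\cdots\alpha_{i_j}\qquad(1\le k\le m).$$ Then $$\Psi_A(t,t_0)=\sum_{k=0}^{m-1}P_k\,\varphi_{k+1}(t),$$ where $\varphi(t)=(\varphi_1(t),\varphi_2(t),\dots,\varphi_m(t))^\top$ is the solution of the initial value problem $$\varphi^\Delta(t)=\begin{pmatrix}\alpha_1&0&0&\dots&0\\1&\alpha_2&0&\ddots&\vdots\\0&1&\alpha_3&\ddots&\vdots\\\vdots&\ddots&\ddots&\ddots&0\\0&\dots&0&1&\alpha_m\end{pmatrix}\varphi(t),\qquad \varphi(t_0)=\begin{pmatrix}1\\0\\0\\\vdots\\0\end{pmatrix}.$$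
   Context: A time scale $\mathbb{T}$ is a nonempty closed subset of $\mathbb{R}$. For $t\in\mathbb{T}$: $\sigma(t)=\inf\{s\in\mathbb{T}:s>t\}$, $\rho(t)=\sup\{s\in\mathbb{T}:s<t\}$ (with $\inf\emptyset=\sup\mathbb{T}$, $\sup\emptyset=\inf\mathbb{T}$), $\mu(t)=\sigma(t)-t$. $\mathbb{T}^\kappa=\mathbb{T}\setminus(\rho(\sup\mathbb{T}),\sup\mathbb{T}]$ if $\sup\mathbb{T}<\infty$, and $\mathbb{T}^\kappa=\mathbb{T}$ otherwise. $\mathbb{H}$ is the skew field of quaternions. A function $f:\mathbb{T}\to\mathbb{H}$ has delta derivative $f^\Delta(t)$ at $t\in\mathbb{T}^\kappa$ if for every $\varepsilon>0$ there is $\delta>0$ with $|f(\sigma(t))-f(s)-f^\Delta(t)(\sigma(t)-s)|\le\varepsilon|\sigma(t)-s|$ for all $s\in(t-\delta,t+\delta)\cap\mathbb{T}$; for vectors and matrices this is entrywise. A constant matrix $A$ belongs to $\mathcal{R}(\mathbb{T},\mathbb{H}^{n\times n})$ if $I_n+\mu(t)A$ is invertible for all $t\in\mathbb{T}^\kappa$; a constant $\alpha\in\mathbb{H}$ belongs to $\mathcal{R}(\mathbb{T},\mathbb{H})$ if $1+\mu(t)\alpha\neq0$ for all $t\in\mathbb{T}^\kappa$. A scalar written to the right of a matrix multiplies every entry on the right. A solution of $\phi^\Delta=A\phi$ is a delta differentiable $\phi:\mathbb{T}\to\mathbb{H}^n$ satisfying the equation at every $t\in\mathbb{T}^\kappa$.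 Functions $x_1,\dots,x_n:\mathbb{T}\to\mathbb{H}^n$ are right linearly independent on $\mathbb{T}$ if $\sum_i x_i(t)\alpha_i=0$ for all $t\in\mathbb{T}$, with $\alpha_i\in\mathbb{H}$, implies all $\alpha_i=0$. A fundamental solution matrix $M(t)$ is an $n\times n$ matrix function whose columns are $n$ right linearly independent solutions. The state-transition matrix is $\Psi_A(t,s)=M(t)M^{-1}(s)$, for any fundamental solution matrix $M$ (it does not depend on the choice of $M$). *)

(* Defs.v *)
From HB Require Import structures.
From mathcomp Require Import all_boot all_order all_algebra.
From mathcomp Require Import ring.
From mathcomp Require Import mathcomp_extra boolp classical_sets reals topology normedtype.

Set Implicit Arguments.
Unset Strict Implicit.
Unset Printing Implicit Defensive.

Import Order.TTheory GRing.Theory Num.Theory.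
Import numFieldNormedType.Exports.

Local Open Scope classical_set_scope.
Local Open Scope ring_scope.

(* [Quat a b c d] is a + b i + c j + d k. *)
Record quat (R : Type) := Quat { q1 : R; qi : R; qj : R; qk : R }.

Section QuatRing.
Variable R : realType.
Implicit Types p q r : quat R.

Definition quat_tuple q := (q1 q, qi q, qj q, qk q).
Definition tuple_quat (x : R * R * R * R) :=
  let: (a, b, c, d) := x in Quat a b c d.

Lemma quat_tupleK : cancel quat_tuple tuple_quat.
Proof. by case. Qed.

HB.instance Definition _ := Choice.copy (quat R) (can_type quat_tupleK).

Definition addq p q :=
  Quat (q1 p + q1 q) (qi p + qi q) (qj p + qj q) (qk p + qk q).
Definition oppq q := Quat (- q1 q) (- qi q) (- qj q) (- qk q).
Definition mulq p q :=
  Quat (q1 p * q1 q - qi p * qi q - qj p * qj q - qk p * qk q)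
       (q1 p * qi q + qi p * q1 q + qj p * qk q - qk p * qj q)
       (q1 p * qj q - qi p * qk q + qj p * q1 q + qk p * qi q)
       (q1 p * qk q + qi p * qj q - qj p * qi q + qk p * q1 q).

Definition realq (x : R) : quat R := Quat x 0 0 0.

Lemma addqA : associative addq.
Proof. by move=> [? ? ? ?] [? ? ? ?] [? ? ? ?]; rewrite /addq /= !addrA. Qed.
Lemma addqC : commutative addq.
Proof. by move=> [a b c d] [a' b' c' d']; congr Quat; apply: addrC. Qed.
Lemma add0q : left_id (realq 0) addq.
Proof. by move=> [? ? ? ?]; rewrite /addq /= !add0r. Qed.
Lemma addNq : left_inverse (realq 0) oppq addq.
Proof. by move=> [? ? ? ?]; rewrite /addq /= !addNr. Qed.

HB.instance Definition _ :=
  GRing.isZmodule.Build (quat R) addqA addqC add0q addNq.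

Lemma mulqA : associative mulq.
Proof.
by move=> [? ? ? ?] [? ? ? ?] [? ? ? ?]; rewrite /mulq /=; congr Quat; ring.
Qed.
Lemma mul1q : left_id (realq 1) mulq.
Proof. by move=> [? ? ? ?]; rewrite /mulq /=; congr Quat; ring. Qed.
Lemma mulq1 : right_id (realq 1) mulq.
Proof. by move=> [? ? ? ?]; rewrite /mulq /=; congr Quat; ring. Qed.
Lemma mulqDl : left_distributive mulq +%R.
Proof.
by move=> [? ? ? ?] [? ? ? ?] [? ? ? ?]; congr Quat; rewrite /=; ring.
Qed.
Lemma mulqDr : right_distributive mulq +%R.
Proof.
by move=> [? ? ? ?] [? ? ? ?] [? ? ? ?]; congr Quat; rewrite /=; ring.
Qed.
Lemma oneq_neq0 : realq 1 != 0.
Proof. by apply/eqP => -[] /eqP; rewrite oner_eq0. Qed.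

HB.instance Definition _ := GRing.Zmodule_isNzRing.Build (quat R)
  mulqA mul1q mulq1 mulqDl mulqDr oneq_neq0.

Definition normq q : R :=
  Num.sqrt (q1 q ^+ 2 + qi q ^+ 2 + qj q ^+ 2 + qk q ^+ 2).

End QuatRing.

Section QuatMatrix.
Variable R : realType.
Notation H := (quat R).

(* Right multiplication of every entry by a scalar; MathComp's [a *: M] on
   matrices over a noncommutative ring multiplies the entries on the left. *)
Definition rscalemx m n (M : 'M[H]_(m, n)) (a : H) : 'M[H]_(m, n) :=
  \matrix_(i, j) (M i j * a).

Definition is_invmx n (M N : 'M[H]_n) := M *m N = 1%:M /\ N *m M = 1%:M.

(* [unitmx] and [invmx] need a commutative ring. The value is 0 when M is not
   invertible. *)
Definition qinvmx n (M : 'M[H]_n) : 'M[H]_n := xget 0 [set N | is_invmx M N].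

End QuatMatrix.

Section TimeScale.
Variable R : realType.
Notation H := (quat R).
(* Functions on a time scale T are represented by functions on R; only their
   values at points of T are ever used. *)
Implicit Types (T : set R) (t s : R).

Definition time_scale T := T !=set0 /\ closed T.

(* The case distinctions implement inf set0 = sup T and sup set0 = inf T,
   since the library's [inf set0] and [sup set0] are 0. *)
Definition sigma T t : R :=
  if `[< exists2 s, T s & t < s >] then inf [set s | T s /\ t < s] else sup T.

Definition rho T t : R :=
  if `[< exists2 s, T s & s < t >] then sup [set s | T s /\ s < t] else inf T.

Definition mu T t : R := sigma T t - t.

Definition kappa T : set R :=
  if `[< has_ubound T >] then T `\` [set t | rho T (sup T) < t <= sup T]
  else T.

(* Stated as a relation because the derivative is not unique when T is a
   singleton (then kappa T = T). *)
Definition has_delta_deriv T (f : R -> H) t (d : H) :=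
  forall eps : R, 0 < eps -> exists2 delta : R, 0 < delta &
    forall s, T s -> t - delta < s < t + delta ->
      normq (f (sigma T t) - f s - d * realq (sigma T t - s))
        <= eps * `|sigma T t - s|.

Definition has_delta_deriv_mx T m n (F : R -> 'M[H]_(m, n)) t
    (D : 'M[H]_(m, n)) :=
  forall i j, has_delta_deriv T (fun s => F s i j) t (D i j).

Definition regressive_mx T n (A : 'M[H]_n) :=
  forall t, kappa T t -> exists N, is_invmx (1%:M + realq (mu T t) *: A) N.

Definition regressive T (a : H) :=
  forall t, kappa T t -> 1 + realq (mu T t) * a <> 0.

Definition is_solution T n (A : 'M[H]_n) (phi : R -> 'cV[H]_n) :=
  forall t, kappa T t -> has_delta_deriv_mx T phi t (A *m phi t).

Definition right_lin_indep T n k (x : 'I_k -> R -> 'cV[H]_n) :=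
  forall a : 'I_k -> H,
    (forall t, T t -> \sum_i rscalemx (x i t) (a i) = 0) -> forall i, a i = 0.

Definition fundamental_matrix T n (A : 'M[H]_n) (M : R -> 'M[H]_n) :=
  (forall j, is_solution T A (fun t => col j (M t))) /\
  right_lin_indep T (fun j t => col j (M t)).

(* Psi_A(t, s): the common value of M(t) M(s)^-1 over all fundamental
   matrices M. *)
Definition state_transition T n (A : 'M[H]_n) t s : 'M[H]_n :=
  xget 0 [set Psi | (exists M, fundamental_matrix T A M) /\
    forall M, fundamental_matrix T A M -> Psi = M t *m qinvmx (M s)].

End TimeScale.

Section Putzer.
Variable R : realType.
Notation H := (quat R).

(* The scalars alpha_1, ..., alpha_m are stored from index 0, so that alpha_k
   is [alpha`_(k - 1)]. *)
Fixpoint putzer_mx n (A : 'M[H]_n) (alpha : seq H) k : 'M[H]_n :=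
  if k is k'.+1 then
    A *m putzer_mx A alpha k' - rscalemx (putzer_mx A alpha k') alpha`_k'
  else 1%:M.

(* The sum over 1 <= i_1 < ... < i_j <= k of alpha_{i_1} ... alpha_{i_j}: a
   j-subset of 'I_k is such a choice of indices, and the noncommutative product
   over the subset is taken in increasing order of the index. *)
Definition ordered_esym (alpha : seq H) k j : H :=
  \sum_(I : {set 'I_k} | #|I| == j) \prod_(i in I) alpha`_i.

Definition putzer_system m (alpha : m.-tuple H) : 'M[H]_m :=
  \matrix_(i, j) (if i == j then tnth alpha i
                  else if i == j.+1 :> nat then 1 else 0).

Definition putzer_init m : 'cV[H]_m := \col_i (if i == 0 :> nat then 1 else 0).

End Putzer.

(* Main.v *)
(** Put [X t = \sum_k P_k phi_(k+1) t]. The recursion for the [P_k] and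
    [P_m = 0] make every column of [X] a solution of [y^Delta = A y], and
    [X t0 = I]. The sum equals [M t * M(t0)^-1] for every fundamental matrix
    [M] because a solution that vanishes at one point of [T] vanishes
    everywhere.

    For this uniqueness, time-scale induction gives
    [|y t - y s| <= 2 K |y s| (t - s)] whenever [s <= t] and
    [2 K (t - s) <= 1], with [K] larger than the norm of [A]. So zeros of [y]
    propagate in both directions over distances at most [1 / (4 K)].
    Across larger gaps [(t, sigma t)] they propagate in both directions because
    [I + mu A] is invertible. Finitely many such steps join any two points. *)

Require Import Defs.
From HB Require Import structures.
From mathcomp Require Import all_boot all_order all_algebra.
From mathcomp Require Import ring lra.
From mathcomp Require Import mathcomp_extra boolp classical_sets reals topology normedtype.

Set Implicit Arguments.
Unset Strict Implicit.
Unset Printing Implicit Defensive.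

Import Order.TTheory GRing.Theory Num.Theory.
Import numFieldNormedType.Exports.

Local Open Scope classical_set_scope.
Local Open Scope ring_scope.

(** * The l1 norm of a quaternion matrix *)

Section L1Norm.
Variable R : realType.
Notation H := (quat R).
Implicit Types (p q : H) (x : R).

Lemma quatE p q :
  q1 p = q1 q -> qi p = qi q -> qj p = qj q -> qk p = qk q -> p = q.
Proof. by case: p q => [a b c d] [a' b' c' d'] /= -> -> -> ->. Qed.

Lemma realqC x q : realq x * q = q * realq x.
Proof. by apply: quatE => /=; ring. Qed.

Lemma realqB x y : realq (x - y) = realq x - realq y :> H.
Proof. by apply: quatE => /=; ring. Qed.

(** The l1 norm of the coordinates replaces [normq]: its triangle and product inequalities reduce to
    those of real absolute values, and the two norms agree up to a factor 4. *)
Definition l1q q : R := `|q1 q| + `|qi q| + `|qj q| + `|qk q|.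

Lemma l1q_ge0 q : 0 <= l1q q.
Proof. by rewrite !addr_ge0. Qed.

Lemma l1q0 : l1q 0 = 0.
Proof. by rewrite /l1q /= normr0 !addr0. Qed.

Lemma l1q_eq0 q : l1q q = 0 -> q = 0.
Proof.
move=> q0; have [h1 hi hj hk] := And4 (normr_ge0 (q1 q)) (normr_ge0 (qi q))
  (normr_ge0 (qj q)) (normr_ge0 (qk q)).
by rewrite /l1q in q0; apply: quatE => /=; apply/eqP; rewrite -normr_eq0; apply/eqP; lra.
Qed.

Lemma l1qN q : l1q (- q) = l1q q.
Proof. by rewrite /l1q /= !normrN. Qed.

Lemma l1qD p q : l1q (p + q) <= l1q p + l1q q.
Proof.
have [h1 hi hj hk] := And4 (ler_normD (q1 p) (q1 q)) (ler_normD (qi p) (qi q))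
  (ler_normD (qj p) (qj q)) (ler_normD (qk p) (qk q)).
by rewrite /l1q /=; lra.
Qed.

Lemma l1q_realM x q : l1q (realq x * q) = `|x| * l1q q.
Proof.
by rewrite /l1q /= !mul0r !(subr0, addr0) !normrM; ring.
Qed.

Lemma l1qM p q : l1q (p * q) <= l1q p * l1q q.
Proof.
have n4 (a b c d : R) : `|a + b + c + d| <= `|a| + `|b| + `|c| + `|d|.
  have := ler_normD (a + b + c) d; have := ler_normD (a + b) c.
  by have := ler_normD a b; lra.
rewrite /l1q /=.
case: p q => [a b c d] [a' b' c' d'] /=.
(* The sixteen products in the four coordinates are, up to sign, exactly the terms of the expanded
   product of the two norms. *)
have := n4 (a * a') (- (b * b')) (- (c * c')) (- (d * d')).
have := n4 (a * b') (b * a') (c * d') (- (d * c')).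
have := n4 (a * c') (- (b * d')) (c * a') (d * b').
have := n4 (a * d') (b * c') (- (c * b')) (d * a').
rewrite !normrN !normrM => h1 h2 h3 h4.
rewrite !mulrDl !mulrDr; lra.
Qed.

Lemma normq_le_l1q q : Defs.normq q <= l1q q.
Proof.
rewrite /Defs.normq -[leRHS]ger0_norm ?l1q_ge0 // -sqrtr_sqr ler_sqrt ?sqr_ge0 //.
rewrite -(real_normK (num_real (q1 q))) -(real_normK (num_real (qi q))).
rewrite -(real_normK (num_real (qj q))) -(real_normK (num_real (qk q))) /l1q.
have := normr_ge0 (q1 q); have := normr_ge0 (qi q).
have := normr_ge0 (qj q); have := normr_ge0 (qk q).
move: `|_| `|_| `|_| `|_| => a b c d a0 b0 c0 d0.
have := mulr_ge0 a0 b0; have := mulr_ge0 a0 c0; have := mulr_ge0 a0 d0.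
have := mulr_ge0 b0 c0; have := mulr_ge0 b0 d0; have := mulr_ge0 c0 d0.
by nra.
Qed.

Lemma l1q_le_normq q : l1q q <= 4 * Defs.normq q.
Proof.
have s0 (a : R) : 0 <= a ^+ 2 by exact: sqr_ge0.
have le1 (a b : R) : a ^+ 2 <= b -> `|a| <= Num.sqrt b.
  move=> ab; rewrite -sqrtr_sqr ler_sqrt //; exact: le_trans ab.
have h1 : `|q1 q| <= Defs.normq q.
  by apply: le1; have := (s0 (qi q), s0 (qj q), s0 (qk q)) => -[[]]; lra.
have h2 : `|qi q| <= Defs.normq q.
  by apply: le1; have := (s0 (q1 q), s0 (qj q), s0 (qk q)) => -[[]]; lra.
have h3 : `|qj q| <= Defs.normq q.
  by apply: le1; have := (s0 (qi q), s0 (q1 q), s0 (qk q)) => -[[]]; lra.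
have h4 : `|qk q| <= Defs.normq q.
  by apply: le1; have := (s0 (qi q), s0 (qj q), s0 (q1 q)) => -[[]]; lra.
by rewrite /l1q; lra.
Qed.

Definition l1mx m n (M : 'M[H]_(m, n)) : R := \sum_i \sum_j l1q (M i j).

Lemma l1mx_ge0 m n (M : 'M[H]_(m, n)) : 0 <= l1mx M.
Proof. by do 2!apply: sumr_ge0 => ? _; apply: l1q_ge0. Qed.

Lemma l1q_le_l1mx m n (M : 'M[H]_(m, n)) i j : l1q (M i j) <= l1mx M.
Proof.
rewrite /l1mx (bigD1 i) //= (bigD1 j) //= -addrA lerDl addr_ge0 //.
  by apply: sumr_ge0 => ? _; apply: l1q_ge0.
by do 2!apply: sumr_ge0 => ? _; apply: l1q_ge0.
Qed.

Lemma l1mx0 m n : l1mx (0 : 'M[H]_(m, n)) = 0.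
Proof. by do 2!apply: big1 => ? _; rewrite mxE l1q0. Qed.

Lemma l1mx_eq0 m n (M : 'M[H]_(m, n)) : l1mx M = 0 -> M = 0.
Proof.
move=> M0; apply/matrixP => i j; rewrite mxE; apply: l1q_eq0.
by apply/eqP; rewrite eq_le l1q_ge0 andbT -M0 l1q_le_l1mx.
Qed.

Lemma l1mxN m n (M : 'M[H]_(m, n)) : l1mx (- M) = l1mx M.
Proof. by do 2!apply: eq_bigr => ? _; rewrite mxE l1qN. Qed.

Lemma l1mxD m n (M N : 'M[H]_(m, n)) : l1mx (M + N) <= l1mx M + l1mx N.
Proof.
rewrite /l1mx -big_split ler_sum // => i _; rewrite -big_split ler_sum // => j _.
by rewrite mxE l1qD.
Qed.

Lemma l1mxB m n (M N : 'M[H]_(m, n)) : l1mx (M - N) <= l1mx M + l1mx N.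
Proof. by rewrite -(l1mxN N) l1mxD. Qed.

Lemma l1mxZ m n x (M : 'M[H]_(m, n)) : l1mx (realq x *: M) = `|x| * l1mx M.
Proof.
rewrite /l1mx mulr_sumr; apply: eq_bigr => i _; rewrite mulr_sumr.
by apply: eq_bigr => j _; rewrite mxE l1q_realM.
Qed.

Lemma l1mxM m n r (M : 'M[H]_(m, n)) (N : 'M[H]_(n, r)) :
  l1mx (M *m N) <= l1mx M * l1mx N.
Proof.
have sumq (I : finType) (F : I -> H) : l1q (\sum_i F i) <= \sum_i l1q (F i).
  elim/big_rec2: _ => [|i y q _ le_qy]; first by rewrite l1q0.
  by apply: le_trans (l1qD _ _) _; rewrite lerD2l.
rewrite [l1mx M]/l1mx mulr_suml ler_sum // => i _.
rewrite mulr_suml; apply: (@le_trans _ _ (\sum_j \sum_k l1q (M i k) * l1q (N k j))).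
  apply: ler_sum => j _; rewrite mxE; apply: le_trans (sumq _ _) _.
  by apply: ler_sum => k _; apply: l1qM.
rewrite exchange_big; apply: ler_sum => k _ /=.
rewrite -mulr_sumr ler_wpM2l ?l1q_ge0 // /l1mx (bigD1 k) //= lerDl.
by do 2!apply: sumr_ge0 => ? _; apply: l1q_ge0.
Qed.

(** Real quaternions are central; a general scalar acting on the left does not pass through a left
    matrix factor. *)
Lemma realq_mulmxr m n r x (M : 'M[H]_(m, n)) (N : 'M[H]_(n, r)) :
  M *m (realq x *: N) = realq x *: (M *m N).
Proof.
apply/matrixP => i j; rewrite !mxE mulr_sumr; apply: eq_bigr => k _.
by rewrite !mxE !mulrA realqC.
Qed.

End L1Norm.

(** * Delta derivatives of matrix functions *)

Section DeltaDerivative.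
Variable R : realType.
Notation H := (quat R).
Implicit Types (T : set R) (t s d : R).

Lemma ex_common_radius (I : finType) (P : I -> R -> Prop) :
  (forall i, exists2 d, 0 < d & P i d) ->
  (forall i d e, d <= e -> P i e -> P i d) ->
  exists2 d, 0 < d & forall i, P i d.
Proof.
move=> exP mono.
have /choice [f fP] : forall i, exists d, 0 < d /\ P i d.
  by move=> i; have [d d0 Pd] := exP i; exists d.
(* The seed 1 keeps the minimum positive when [I] is empty. *)
exists (\big[Num.min/1]_i f i).
  by rewrite lt_bigmin // => i _; have [] := fP i.
by move=> i; apply: mono (fP i).2; apply: bigmin_le_cond.
Qed.

(** Equivalence of the norms merges the entrywise conditions into one estimate. The increment
    [sigma T t - s] is real, hence central, so it may scale [D] from the left. *)
Lemma has_delta_deriv_mxP T m n (F : R -> 'M[H]_(m, n)) t (D : 'M[H]_(m, n)) :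
  has_delta_deriv_mx T F t D <->
  forall eps, 0 < eps -> exists2 delta, 0 < delta &
    forall s, T s -> t - delta < s < t + delta ->
      l1mx (F (sigma T t) - F s - realq (sigma T t - s) *: D)
        <= eps * `|sigma T t - s|.
Proof.
split=> FD; last first.
  move=> i j eps /FD[delta d0 dP]; exists delta => // s Ts /(dP s Ts).
  apply: le_trans; apply: le_trans (normq_le_l1q _) _.
  have := l1q_le_l1mx (F (sigma T t) - F s - realq (sigma T t - s) *: D) i j.
  by rewrite !mxE realqC.
(* The 4 comes from [l1q_le_normq] and [n * m] counts the entries; the 1 keeps the denominator
   positive for empty matrices. *)
move=> eps eps0; pose e := eps / (4 * (n * m)%:R + 1).
have N0 : 0 < 4 * (n * m)%:R + 1 :> R by have := ler0n R (n * m); lra.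
have e0 : 0 < e by rewrite divr_gt0.
pose P (ij : 'I_m * 'I_n) delta :=
  forall s, T s -> t - delta < s < t + delta ->
    Defs.normq (F (sigma T t) ij.1 ij.2 - F s ij.1 ij.2 -
      D ij.1 ij.2 * realq (sigma T t - s)) <= e * `|sigma T t - s|.
have [ij|ij d d' dd' dP s Ts /andP[s1 s2]|d d0 dP] := @ex_common_radius _ P.
- by have [d d0 dP] := FD ij.1 ij.2 e e0; exists d.
- by apply: dP => //; apply/andP; split; lra.
exists d => // s Ts hs.
apply: (@le_trans _ _ (\sum_(i < m) \sum_(j < n) 4 * (e * `|sigma T t - s|))).
  apply: ler_sum => i _; apply: ler_sum => j _; apply: le_trans (l1q_le_normq _) _.
  by rewrite ler_wpM2l // !mxE realqC; apply: (dP (i, j)).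
rewrite !sumr_const !card_ord -mulrnA -[_ *+ _]mulr_natr.
have -> : 4 * (e * `|sigma T t - s|) * (n * m)%:R =
  4 * (n * m)%:R * e * `|sigma T t - s| by ring.
rewrite ler_wpM2r // /e mulrA ler_pdivrMr // mulrC.
by rewrite ler_wpM2l ?(ltW eps0) //; lra.
Qed.

Lemma has_delta_deriv_mxM T m n r (B : 'M[H]_(r, m)) (F : R -> 'M[H]_(m, n)) t D :
  has_delta_deriv_mx T F t D ->
  has_delta_deriv_mx T (fun s => B *m F s) t (B *m D).
Proof.
move=> /has_delta_deriv_mxP FD; apply/has_delta_deriv_mxP => eps eps0.
(* The constant factor enlarges the error by at most its norm; adding 1 avoids dividing by 0. *)
have B1 : 0 < l1mx B + 1 by have := l1mx_ge0 B; lra.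
have [|d d0 dP] := FD (eps / (l1mx B + 1)); first by rewrite divr_gt0.
exists d => // s Ts /(dP s Ts) h.
rewrite -realq_mulmxr -!mulmxBr; apply: le_trans (l1mxM _ _) _.
apply: le_trans (ler_wpM2l (l1mx_ge0 _) h) _.
rewrite !mulrA ler_wpM2r // ler_pdivrMr // mulrC.
by rewrite ler_wpM2l ?(ltW eps0) //; lra.
Qed.

Lemma has_delta_deriv_mxMr T m n r (B : 'M[H]_(n, r)) (F : R -> 'M[H]_(m, n)) t D :
  has_delta_deriv_mx T F t D ->
  has_delta_deriv_mx T (fun s => F s *m B) t (D *m B).
Proof.
move=> /has_delta_deriv_mxP FD; apply/has_delta_deriv_mxP => eps eps0.
have B1 : 0 < l1mx B + 1 by have := l1mx_ge0 B; lra.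
have [|d d0 dP] := FD (eps / (l1mx B + 1)); first by rewrite divr_gt0.
exists d => // s Ts /(dP s Ts) h.
rewrite scalemxAl -!mulmxBl; apply: le_trans (l1mxM _ _) _.
apply: le_trans (ler_wpM2r (l1mx_ge0 _) h) _.
rewrite mulrAC ler_wpM2r // mulrAC ler_pdivrMr //.
by rewrite ler_wpM2l ?(ltW eps0) //; lra.
Qed.

Lemma has_delta_deriv_mxB T m n (F G : R -> 'M[H]_(m, n)) t D E :
  has_delta_deriv_mx T F t D -> has_delta_deriv_mx T G t E ->
  has_delta_deriv_mx T (fun s => F s - G s) t (D - E).
Proof.
move=> /has_delta_deriv_mxP FD /has_delta_deriv_mxP GE.
apply/has_delta_deriv_mxP => eps eps0.
have e2 : 0 < eps / 2 by lra.
have [d d0 dP] := FD _ e2; have [d' d'0 d'P] := GE _ e2.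
exists (Num.min d d'); first by rewrite lt_min d0.
move=> s Ts /andP[s1 s2]; have [m1 m2] : Num.min d d' <= d /\ Num.min d d' <= d'.
  by rewrite !ge_min !lexx orbT.
have h : t - d < s < t + d by apply/andP; split; lra.
have h' : t - d' < s < t + d' by apply/andP; split; lra.
rewrite scalerBr.
set a := realq _ *: D; set b := realq _ *: E.
have -> : F (sigma T t) - G (sigma T t) - (F s - G s) - (a - b) =
  (F (sigma T t) - F s - a) - (G (sigma T t) - G s - b).
  by apply/matrixP => i j; rewrite !mxE; apply: quatE => /=; ring.
apply: le_trans (l1mxB _ _) _.
have := dP s Ts h; have := d'P s Ts h'; rewrite -/a -/b; lra.
Qed.

(* At [s = t] the defining inequality holds for every [eps], so it is an
   equality. *)
Lemma delta_deriv_sigma T m n (F : R -> 'M[H]_(m, n)) t D : T t ->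
  has_delta_deriv_mx T F t D ->
  F (sigma T t) = F t + realq (mu T t) *: D.
Proof.
move=> Tt /has_delta_deriv_mxP FD.
suff /l1mx_eq0/eqP : l1mx (F (sigma T t) - F t - realq (mu T t) *: D) = 0.
  by rewrite subr_eq0 subr_eq addrC => /eqP.
apply/eqP; rewrite eq_le l1mx_ge0 andbT; apply/ler_addgt0Pl => e e0.
rewrite addr0; have m1 : 0 < `|mu T t| + 1 by have := normr_ge0 (mu T t); lra.
have [|d d0 dP] := FD (e / (`|mu T t| + 1)); first by rewrite divr_gt0.
apply: le_trans (dP t Tt _) _; first by apply/andP; split; lra.
by rewrite mulrAC ler_pdivrMr // ler_wpM2l ?(ltW e0) //; rewrite /mu; lra.
Qed.

(* The error term controls [F t - F s] only up to [eps * mu T t]: at a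
   left-dense right-scattered point this gives continuity and nothing more. *)
Lemma delta_deriv_near T m n (F : R -> 'M[H]_(m, n)) t D : T t ->
  has_delta_deriv_mx T F t D ->
  forall eps, 0 < eps -> exists2 delta, 0 < delta &
    forall s, T s -> t - delta < s < t + delta ->
      l1mx (F s - F t - realq (s - t) *: D) <= eps * (`|mu T t| + `|s - t|).
Proof.
move=> Tt FD eps eps0; have Fs := delta_deriv_sigma Tt FD.
move/has_delta_deriv_mxP: FD => /(_ _ eps0)[d d0 dP].
exists d => // s Ts hs; have := dP s Ts hs; rewrite Fs.
have -> : F t + realq (mu T t) *: D - F s - realq (sigma T t - s) *: D =
  - (F s - F t - realq (s - t) *: D).
  have -> : sigma T t - s = mu T t - (s - t) by rewrite /mu; ring.
  rewrite realqB scalerBl; set x := realq _ *: _; set y := realq _ *: _.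
  rewrite !opprB addrC addrA; apply/matrixP => i j; rewrite !mxE.
  by apply: quatE => /=; ring.
rewrite l1mxN => /le_trans-> //; rewrite ler_wpM2l ?(ltW eps0) //.
by have -> : sigma T t - s = mu T t - (s - t) by [rewrite /mu; ring]; apply: ler_normB.
Qed.

End DeltaDerivative.

(** * Induction on a time scale *)

Section TimeScaleInduction.
Variable R : realType.
Implicit Types (T A : set R) (t s u x : R).

Lemma closed_approx T x : closed T ->
  (forall e, 0 < e -> exists2 u, T u & `|x - u| < e) -> T x.
Proof.
move=> /closure_id clT Tx; rewrite clT => B /nbhs_ballP[e e0 eB]; have [u Tu xu] := Tx e e0.
by exists u; split=> //; apply: eB; rewrite -ball_normE.
Qed.

Lemma closed_sup T A : closed T -> A `<=` T -> has_sup A -> T (sup A).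
Proof.
move=> clT AT supA; apply: closed_approx => // e e0.
have [u Au ltu] := sup_adherent e0 supA; exists u; first exact: AT.
have uA : u <= sup A by apply: sup_upper_bound.
by rewrite ger0_norm; lra.
Qed.

Lemma closed_inf T A : closed T -> A `<=` T -> has_inf A -> T (inf A).
Proof.
move=> clT AT infA; apply: closed_approx => // e e0.
have [u Au ltu] := inf_adherent e0 infA; exists u; first exact: AT.
have uA : inf A <= u by apply: ge_inf => //; case: infA.
by rewrite ler0_norm; lra.
Qed.

Section Sigma.
Variables (T : set R) (t b : R).
Hypotheses (clT : closed T) (Tt : T t) (Tb : T b) (ltb : t < b).

Lemma sigmaE : sigma T t = inf [set s | T s /\ t < s].
Proof. by rewrite /sigma ifT //; apply/asboolP; exists b. Qed.

Let has_inf_right : has_inf [set s | T s /\ t < s].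
Proof. by split; [exists b | exists t => s [_ /ltW]]. Qed.

Lemma in_sigma : T (sigma T t).
Proof. by rewrite sigmaE; apply: closed_inf => // s []. Qed.

Lemma le_sigma : t <= sigma T t.
Proof. by rewrite sigmaE lb_le_inf //; [case: has_inf_right|move=> s [_ /ltW]]. Qed.

Lemma sigma_le u : T u -> t < u -> sigma T t <= u.
Proof. by move=> Tu tu; rewrite sigmaE; apply: ge_inf => //; case: has_inf_right. Qed.

Lemma sigma_dense e : sigma T t = t -> 0 < e -> exists2 u, T u & t < u < t + e.
Proof.
rewrite sigmaE => st e0; have [u [Tu tu]] := inf_adherent e0 has_inf_right.
by rewrite st => ue; exists u; rewrite ?tu.
Qed.

(** The point [t] is itself among the points of [T] below [sup T], so [t <= rho T (sup T)] and [t]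
    is not removed. *)
Lemma kappa_lt : kappa T t.
Proof.
rewrite /kappa; case: ifP => // /asboolP ubT; split=> //= /andP[].
have lesup : b <= sup T by apply: ub_le_sup.
rewrite /rho ifT; last by apply/asboolP; exists t => //; apply: lt_le_trans lesup.
rewrite ltNge => /negP[]; apply: ub_le_sup; first by exists (sup T) => s [_ /ltW].
by split=> //=; apply: lt_le_trans lesup.
Qed.

End Sigma.

(** Covers a left-dense maximum of [T], which [kappa_lt] does not reach. If [t] were removed, some
    point of [T] would lie strictly between [rho T (sup T)] and [t], above the supremum that bounds
    it. *)
Lemma kappa_left_dense T t : T t ->
  (forall e, 0 < e -> exists2 u, T u & t - e < u < t) -> kappa T t.
Proof.
move=> Tt dense; rewrite /kappa; case: ifP => // /asboolP ubT; split=> //= /andP[].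
have [u0 Tu0 /andP[_ u0t]] := dense 1 ltr01.
have supt : t <= sup T by apply: ub_le_sup.
rewrite /rho ifT; last by apply/asboolP; exists u0 => //; lra.
set B := [set s | _] => ltt let_.
have [|u Tu /andP[u1 u2]] := dense (t - sup B); first by lra.
have : u <= sup B; last by lra.
by apply: ub_le_sup; [exists (sup T) => s [_ /ltW]|split=> //=; lra].
Qed.

(** Real induction adapted to a closed set. Let [c] be the supremum of the points up to which [P]
    holds throughout. The left-dense hypothesis puts [c] in that set; if [c] fell short of [t], the
    jump or the right-dense hypothesis would extend the set past [c]. *)
Lemma time_scale_ind T (P : R -> Prop) (s b : R) :
  closed T -> T s -> T b -> P s ->
  (forall t, T t -> s <= t < b -> P t -> P (sigma T t)) ->
  (forall t, T t -> s <= t < b -> sigma T t = t -> P t ->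
     exists2 d, 0 < d & forall u, T u -> t < u < t + d -> P u) ->
  (forall t, T t -> s < t <= b ->
     (forall e, 0 < e -> exists2 u, T u & t - e < u < t) ->
     (forall u, T u -> s <= u < t -> P u) -> P t) ->
  forall t, T t -> s <= t <= b -> P t.
Proof.
move=> clT Ts Tb Ps Psigma Pright Pleft t Tt /andP[st tb].
pose S := [set u | [/\ T u, s <= u <= b & forall v, T v -> s <= v <= u -> P v]].
have Ss : S s.
  split=> //; first by rewrite lexx (le_trans st).
  by move=> v _ /andP[h1 h2]; have -> : v = s by apply/eqP; rewrite eq_le h1 h2.
have supS : has_sup S by split; [exists s|exists b => u [_ /andP[]]].
pose c := sup S.
have leS u : S u -> u <= c by move=> Su; apply: sup_upper_bound.
have Tc : T c by apply: closed_sup => // u [].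
have sc : s <= c by apply: leS.
have cb : c <= b by apply: ge_sup; [exists s|move=> u [_ /andP[]]].
have Pbelow v : T v -> s <= v < c -> P v.
  move=> Tv /andP[sv vc]; have vc0 : 0 < c - v by lra.
  have [u [Tu _ Pu] ltu] := sup_adherent vc0 supS.
  by apply: Pu => //; rewrite sv; rewrite -/c in ltu; lra.
have Sc : S c.
  split=> //; first by rewrite sc.
  move=> v Tv /andP[sv]; rewrite le_eqVlt => /orP[/eqP->|vc]; last first.
    by apply: Pbelow => //; rewrite sv.
  (* A supremum outside [S] is approached by points of [S] from the left, which is what [Pleft]
     requires. *)
  have [Sc|nSc] := pselect (S c); first by case: Sc => _ _; apply; rewrite ?sc ?lexx.
  have sc' : s < c.
    by rewrite lt_neqAle sc andbT; apply/eqP => E; apply: nSc; rewrite -E.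
  apply: Pleft => //; first by rewrite sc'.
  move=> e e0; have [u Su ltu] := sup_adherent e0 supS; exists u; first by case: Su.
  apply/andP; split; first by rewrite /c.
  by rewrite lt_neqAle leS // andbT; apply/eqP => E; apply: nSc; rewrite -E.
have [tc|ct] := leP t c; first by case: Sc => _ _; apply; rewrite ?st.
exfalso.
(* Any extension of [P] from [c] to a later [u] would put [u] in [S], against the choice of [c]. *)
have Scat u : T u -> c < u <= b -> (forall v, T v -> c < v <= u -> P v) -> False.
  move=> Tu /andP[cu ub] Pu; have : u <= c; last by lra.
  apply: leS; split=> //; first by apply/andP; split; lra.
  move=> v Tv /andP[sv vu]; have [vc|cv] := leP v c; last by apply: Pu => //; rewrite cv.
  by case: Sc => _ _; apply => //; rewrite sv.
have scb : s <= c < b by apply/andP; split; lra.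
have Pc : P c by case: Sc => _ _; apply => //; rewrite sc lexx.
have cs := le_sigma Tt ct; have sigt := sigma_le Tt ct Tt ct.
move: (cs); rewrite le_eqVlt => /orP[/eqP E|clts]; last first.
  apply: (Scat (sigma T c)); first exact: in_sigma Tt ct.
    by rewrite clts; lra.
  move=> v Tv /andP[cv vs]; have -> : v = sigma T c.
    by apply/eqP; rewrite eq_le vs (sigma_le Tt ct).
  exact: Psigma.
have [d d0 Pd] := Pright c Tc scb (esym E) Pc.
have [|u Tu /andP[cu]] := @sigma_dense T c t Tt ct (Num.min d (b - c)) (esym E).
  by rewrite lt_min d0; lra.
have [m1 m2] : Num.min d (b - c) <= d /\ Num.min d (b - c) <= b - c.
  by rewrite !ge_min !lexx orbT.
move=> ud; apply: (Scat u) => //; first by apply/andP; split; lra.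
by move=> v Tv /andP[cv vu]; apply: Pd => //; apply/andP; split; lra.
Qed.

End TimeScaleInduction.

(** * Uniqueness of solutions *)

Section Uniqueness.
Variables (R : realType) (T : set R) (n : nat) (A : 'M[quat R]_n).
Variable y : R -> 'cV[quat R]_n.
Hypotheses (clT : closed T) (yA : is_solution T A y).
Variable K : R.
Hypotheses (K0 : 0 < K) (AK : l1mx A <= K).

(* The linear bound reproduces itself because the horizon [b - s] is at most
   [1 / (2 K)]; the slack [eps] absorbs the error terms of the derivative. *)
Lemma solution_increment_le (s b eps : R) : T s -> T b -> 0 < eps ->
  2 * K * (b - s) <= 1 ->
  forall t, T t -> s <= t <= b ->
    l1mx (y t - y s) <= 2 * K * (l1mx (y s) + eps) * (t - s).
Proof.
move=> Ts Tb eps0 Kbs; set a := l1mx (y s) + eps.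
have a0 : 0 < a by have := l1mx_ge0 (y s); rewrite /a; lra.
have Ka0 : 0 < 2 * K * a by rewrite !mulr_gt0.
(* While the bound holds, the short horizon gives [l1mx (y t) <= 2 * a - eps], so the derivative
   stays below the slope [2 * K * a] with margin [K * eps]. *)
have speed (t : R) : s <= t < b -> l1mx (y t - y s) <= 2 * K * a * (t - s) ->
    l1mx (A *m y t) <= 2 * K * a - K * eps.
  move=> /andP[st tb] yt; apply: le_trans (l1mxM _ _) _.
  have yta : l1mx (y t - y s) <= a.
    apply: le_trans yt _; have -> : 2 * K * a * (t - s) = a * (2 * K * (t - s)) by ring.
    rewrite -[leRHS]mulr1 ler_wpM2l ?(ltW a0) //; apply: le_trans Kbs.
    by rewrite ler_wpM2l ?lerD2r ?(ltW tb) ?mulr_ge0 ?(ltW K0).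
  have yt2 : l1mx (y t) <= 2 * a - eps.
    have := l1mxD (y t - y s) (y s); rewrite subrK; rewrite /a in yta *; lra.
  apply: le_trans (_ : K * l1mx (y t) <= _); first by rewrite ler_wpM2r ?l1mx_ge0.
  by have -> : 2 * K * a - K * eps = K * (2 * a - eps) by [ring]; rewrite ler_wpM2l ?(ltW K0).
apply: (time_scale_ind clT Ts Tb).
- by rewrite !subrr l1mx0 mulr0.
- move=> t Tt hst yt; have /andP[st tb] := hst.
  have kt : kappa T t := kappa_lt Tt Tb tb.
  rewrite (delta_deriv_sigma Tt (yA kt)).
  have mu0 : 0 <= mu T t by rewrite /mu subr_ge0 (le_sigma Tb tb).
  rewrite addrAC; apply: le_trans (l1mxD _ _) _.
  have -> : 2 * K * a * (sigma T t - s) = 2 * K * a * (t - s) + mu T t * (2 * K * a).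
    by rewrite /mu; ring.
  rewrite lerD // l1mxZ ger0_norm // ler_wpM2l //.
  have := speed t hst yt; have := mulr_gt0 K0 eps0; lra.
- move=> t Tt hst sigt yt; have /andP[st tb] := hst.
  have kt : kappa T t := kappa_lt Tt Tb tb.
  (* Here [mu T t = 0], so the derivative error over [u - t] can be made to fit the margin left by
     [speed]. *)
  have Ke : 0 < K * eps by rewrite mulr_gt0.
  have [d d0 dP] := delta_deriv_near Tt (yA kt) Ke.
  exists d => // u Tu /andP[tu utd].
  have /(dP u Tu) : t - d < u < t + d by apply/andP; split; lra.
  rewrite /mu sigt subrr normr0 add0r ger0_norm ?subr_ge0 ?(ltW tu) // => near_tu.
  have -> : y u - y s = (y t - y s) + (y u - y t - realq (u - t) *: (A *m y t)) +
      realq (u - t) *: (A *m y t).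
    by apply/matrixP => i j; rewrite !mxE; apply: quatE => /=; ring.
  apply: le_trans (l1mxD _ _) _; rewrite l1mxZ ger0_norm ?subr_ge0 ?(ltW tu) //.
  have h := l1mxD (y t - y s) (y u - y t - realq (u - t) *: (A *m y t)).
  have : (u - t) * l1mx (A *m y t) <= (u - t) * (2 * K * a - K * eps).
    by rewrite ler_wpM2l ?subr_ge0 ?(ltW tu) //; apply: speed.
  have -> : 2 * K * a * (u - s) =
    2 * K * a * (t - s) + K * eps * (u - t) + (u - t) * (2 * K * a - K * eps) by ring.
  lra.
- move=> t Tt /andP[st tb] dense below.
  have kt : kappa T t := kappa_left_dense Tt dense.
  (* Only continuity is used at a left-dense point: some [u] just left of [t] has [y u] within [e]
     of [y t], and its bound is below the one wanted at [t]. *)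
  apply/ler_addgt0Pl => e e0.
  pose D := A *m y t; have D1 : 0 < l1mx D + 1 by have := l1mx_ge0 D; lra.
  have m1 : 0 < `|mu T t| + 1 by have := normr_ge0 (mu T t); lra.
  have e2 : 0 < e / 2 by lra.
  have [d d0 dP] := delta_deriv_near Tt (yA kt) (divr_gt0 e2 m1).
  (* The four bounds on [t - u] give, in order, the derivative estimate, [s <= u], an error factor
     at most [|mu T t| + 1], and a linear term at most [e / 2]. *)
  pose r := Num.min (Num.min d (t - s)) (Num.min 1 (e / 2 / (l1mx D + 1))).
  have r0 : 0 < r by rewrite !lt_min d0 ltr01 divr_gt0 // subr_gt0 st.
  have [u Tu /andP[ru ut]] := dense r r0.
  have [r1 r2 r3 r4] : [/\ r <= d, r <= t - s, r <= 1 & r <= e / 2 / (l1mx D + 1)].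
    by split; rewrite !ge_min lexx ?orbT.
  have /(dP u Tu) : t - d < u < t + d by apply/andP; split; lra.
  have -> : `|u - t| = t - u by rewrite ler0_norm ?opprB // subr_le0 ltW.
  move=> near_tu.
  have near2 : l1mx (y u - y t - realq (u - t) *: D) <= e / 2.
    apply: le_trans near_tu _; rewrite mulrAC ler_pdivrMr // ler_wpM2l ?(ltW e2) //.
    by lra.
  have small : (t - u) * l1mx D <= e / 2.
    apply: (@le_trans _ _ ((t - u) * (l1mx D + 1))).
      by rewrite ler_wpM2l ?subr_ge0 ?(ltW ut) //; lra.
    by rewrite -ler_pdivlMr //; lra.
  have yu : l1mx (y u - y s) <= 2 * K * a * (u - s).
    by apply: below => //; apply/andP; split; lra.
  have -> : y t - y s = (y u - y s) - (y u - y t - realq (u - t) *: D) -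
      realq (u - t) *: D.
    by apply/matrixP => i j; rewrite !mxE; apply: quatE => /=; ring.
  apply: le_trans (l1mxB _ _) _; rewrite l1mxZ.
  have -> : `|u - t| = t - u by rewrite ler0_norm ?opprB // subr_le0 ltW.
  have h := l1mxB (y u - y s) (y u - y t - realq (u - t) *: D).
  have : 2 * K * a * (u - s) <= 2 * K * a * (t - s).
    by rewrite ler_wpM2l ?(ltW Ka0) //; lra.
  lra.
Qed.

(** Halving the horizon bounds the increment by half of [l1mx (y s) + eps]. Forward, [y s = 0]
    leaves [l1mx (y t) <= eps / 2]; backward, [y t = 0] lets half of [l1mx (y s)] be absorbed,
    leaving [l1mx (y s) <= eps]. *)
Lemma solution_eq0_close (s t : R) : T s -> T t -> s <= t -> 4 * K * (t - s) <= 1 ->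
  y s = 0 <-> y t = 0.
Proof.
move=> Ts Tt st Kst.
have Kts : 2 * K * (t - s) <= 1 / 2 by lra.
have Kts0 : 0 <= 2 * K * (t - s) by rewrite !mulr_ge0 ?subr_ge0 ?(ltW K0).
have incr (eps : R) : 0 < eps ->
    l1mx (y t - y s) <= (l1mx (y s) + eps) * (1 / 2).
  move=> eps0; apply: le_trans (@solution_increment_le s t eps Ts Tt eps0 _ t Tt _) _.
  - by lra.
  - by rewrite st lexx.
  rewrite mulrAC mulrC ler_wpM2l //.
  by have := l1mx_ge0 (y s); lra.
split=> y0; apply: l1mx_eq0; apply/eqP; rewrite eq_le l1mx_ge0 andbT;
    apply/ler_addgt0Pl => eps eps0; have := incr eps eps0.
  by rewrite y0 subr0 l1mx0; lra.
by rewrite y0 sub0r l1mxN; lra.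
Qed.

Hypothesis regA : regressive_mx T A.

Lemma solution_eq0_sigma t : T t -> kappa T t ->
  y t = 0 <-> y (sigma T t) = 0.
Proof.
move=> Tt kt; rewrite (delta_deriv_sigma Tt (yA kt)).
have -> : y t + realq (mu T t) *: (A *m y t) = (1%:M + realq (mu T t) *: A) *m y t.
  by rewrite mulmxDl mul1mx scalemxAl.
have [N [_ NA]] := regA kt.
split=> [->|y0]; first by rewrite mulmx0.
by rewrite -[y t]mul1mx -NA -mulmxA y0 mulmx0.
Qed.

Lemma solution_eq0_le (s t : R) : T s -> T t -> s <= t -> y s = 0 <-> y t = 0.
Proof.
move=> Ts Tt st.
have [N] : exists N : nat, 4 * K * (t - s) <= N%:R.
  exists (Num.truncn (4 * K * (t - s))).+1.
  by apply: ltW; apply: truncnS_gt.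
elim: N s Ts st => [|N IH] s Ts st KN.
  by apply: solution_eq0_close => //; lra.
have [Kts|Kts] := leP (4 * K * (t - s)) 1; first exact: solution_eq0_close.
pose h := (4 * K)^-1; have K4 : 0 < 4 * K by rewrite mulr_gt0.
have h0 : 0 < h by rewrite invr_gt0.
have Kh : 4 * K * h = 1 by rewrite divff // gt_eqF.
have hst : h < t - s by rewrite -(ltr_pM2l K4) Kh.
(* The last point [c] of [T] within [h] of [s] is reached by a close step. Then [sigma T c] is at
   least [s + h], so a close step and a possibly trivial jump together use up one unit of [N]. *)
pose B := [set u | T u /\ u <= s + h]; pose c := sup B.
have Bs : B s by split=> //; lra.
have supB : has_sup B by split; [exists s|exists (s + h) => u []].
have Tc : T c by apply: closed_sup => // u [].
have sc : s <= c by apply: sup_upper_bound.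
have ch : c <= s + h by apply: ge_sup; [exists s|move=> u []].
have ct : c < t by lra.
have Tsc := in_sigma clT Tt ct.
have sct : sigma T c <= t by apply: (sigma_le Tt ct).
have hsc : s + h <= sigma T c.
  rewrite leNgt; apply/negP => sch.
  have leB u : T u -> u <= s + h -> u <= c by move=> Tu us; apply: sup_upper_bound.
  (* If [sigma T c] were below [s + h], then [c] would be right-dense and a later point of [T] would
     still lie within [h] of [s]. *)
  have scc : sigma T c = c.
    by apply/eqP; rewrite eq_le (le_sigma Tt ct) leB // ltW.
  have [|u Tu /andP[cu us]] := sigma_dense Tt ct scc (_ : 0 < s + h - c); first by lra.
  by have := leB u Tu; lra.
rewrite (solution_eq0_close Ts Tc sc); last first.
  by rewrite -[leRHS]Kh ler_pM2l //; lra.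
rewrite (solution_eq0_sigma Tc (kappa_lt Tc Tt ct)); apply: IH => //.
have : 4 * K * (t - sigma T c) <= 4 * K * (t - s - h) by rewrite ler_pM2l //; lra.
by rewrite -natr1 in KN; lra.
Qed.

End Uniqueness.

Lemma solution_unique (R : realType) (T : set R) n (A : 'M[quat R]_n) y s t :
  closed T -> regressive_mx T A -> is_solution T A y ->
  T s -> T t -> y s = 0 -> y t = 0.
Proof.
move=> clT regA yA Ts Tt.
(* The 1 makes the constant positive even for [A = 0]. *)
have K0 : 0 < l1mx A + 1 by have := l1mx_ge0 A; lra.
have AK : l1mx A <= l1mx A + 1 by lra.
have [st|/ltW ts] := leP s t.
  by move/(solution_eq0_le clT yA K0 AK regA Ts Tt st).
by move/(solution_eq0_le clT yA K0 AK regA Tt Ts ts).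
Qed.

(** * Linear algebra over the quaternions *)

Section RightScaling.
Variable R : realType.
Notation H := (quat R).
Implicit Types a b : H.

Lemma rscalemx1 m n (M : 'M[H]_(m, n)) : rscalemx M 1 = M.
Proof. by apply/matrixP => i j; rewrite !mxE mulr1. Qed.

Lemma rscalemx0r m n (M : 'M[H]_(m, n)) : rscalemx M 0 = 0.
Proof. by apply/matrixP => i j; rewrite !mxE mulr0. Qed.

Lemma rscalemxA m n (M : 'M[H]_(m, n)) a b :
  rscalemx (rscalemx M a) b = rscalemx M (a * b).
Proof. by apply/matrixP => i j; rewrite !mxE mulrA. Qed.

Lemma rscalemxDr m n (M : 'M[H]_(m, n)) a b :
  rscalemx M (a + b) = rscalemx M a + rscalemx M b.
Proof. by apply/matrixP => i j; rewrite !mxE mulrDr. Qed.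

Lemma rscalemx_suml m n (I : finType) (F : I -> 'M[H]_(m, n)) a :
  rscalemx (\sum_i F i) a = \sum_i rscalemx (F i) a.
Proof.
apply/matrixP => i j; rewrite !mxE !summxE mulr_suml.
by apply: eq_bigr => k _; rewrite mxE.
Qed.

Lemma rscalemxZ m n (M : 'M[H]_(m, n)) a b :
  rscalemx (a *: M) b = a *: rscalemx M b.
Proof. by apply/matrixP => i j; rewrite !mxE mulrA. Qed.

Lemma mulmx_rscalemx m n r (B : 'M[H]_(r, m)) (M : 'M[H]_(m, n)) a :
  B *m rscalemx M a = rscalemx (B *m M) a.
Proof.
apply/matrixP => i j; rewrite !mxE mulr_suml.
by apply: eq_bigr => k _; rewrite mxE mulrA.
Qed.

Lemma mulmx_signr m n r (B : 'M[H]_(r, m)) (M : 'M[H]_(m, n)) k :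
  B *m ((-1) ^+ k *: M) = (-1) ^+ k *: (B *m M).
Proof.
rewrite -signr_odd; case: odd; rewrite ?expr1 ?expr0 ?scaleN1r ?scale1r //.
exact: mulmxN.
Qed.

End RightScaling.

(** * Injective quaternion matrices are invertible, by real coordinates *)

Section RealificationRank.
Variables (R : realType) (n : nat).
Notation H := (quat R).

Definition cV_of_real (X : 'M[R]_(n, 4)) : 'cV[H]_n :=
  \col_i Quat (X i 0) (X i 1) (X i 2) (X i 3).

Definition real_of_cV (v : 'cV[H]_n) : 'M[R]_(n, 4) :=
  \matrix_(i, c) nth 0 [:: q1 (v i 0); qi (v i 0); qj (v i 0); qk (v i 0)] c.

Lemma real_of_cVK : cancel real_of_cV cV_of_real.
Proof.
by move=> v; apply/matrixP => i j; rewrite (ord1 j) !mxE; case: (v i 0).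
Qed.

Lemma cV_of_real_inj0 X : cV_of_real X = 0 -> X = 0.
Proof.
move=> X0; apply/matrixP => i c; rewrite mxE.
have := congr1 (fun v : 'cV[H]_n => v i 0) X0; rewrite !mxE => -[x0 x1 x2 x3].
case: c => [[|[|[|[|]]]]] // lc.
- by rewrite -[RHS]x0; congr (X i _); apply: val_inj.
- by rewrite -[RHS]x1; congr (X i _); apply: val_inj.
- by rewrite -[RHS]x2; congr (X i _); apply: val_inj.
- by rewrite -[RHS]x3; congr (X i _); apply: val_inj.
Qed.

(** Over the reals, [M] acts linearly on a space of dimension [4 * n], where injectivity forces
    surjectivity. Preimages of the basis vectors form a right inverse [N]; it is also a left inverse
    because [M *m (N *m M - 1%:M) = 0] and [M] is injective. *)
Lemma injective_mulmx_invertible (M : 'M[H]_n) :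
  (forall v : 'cV[H]_n, M *m v = 0 -> v = 0) -> exists N, is_invmx M N.
Proof.
move=> injM.
pose f X := real_of_cV (M *m cV_of_real X).
have f_lin : linear f.
  move=> a X Y; rewrite /f.
  have -> : cV_of_real (a *: X + Y) = realq a *: cV_of_real X + cV_of_real Y.
    by apply/matrixP => i j; rewrite !mxE; apply: quatE => /=; ring.
  rewrite mulmxDr realq_mulmxr; apply/matrixP => i c; rewrite !mxE.
  set p := \sum_j _; set q := \sum_j _.
  by case: c => [[|[|[|[|]]]]] //= _; ring.
pose g : {linear 'M[R]_(n, 4) -> 'M[R]_(n, 4)} :=
  HB.pack f (GRing.isLinear.Build _ _ _ _ f f_lin).
have free_g : row_free (lin_mx g).
  apply: inj_row_free => v; rewrite mul_rV_lin => /(canRL mxvecK).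
  rewrite linear0 => /(congr1 cV_of_real); rewrite real_of_cVK.
  have -> : cV_of_real 0 = 0 by apply/matrixP => i j; rewrite !mxE.
  by move/injM/cV_of_real_inj0/(canRL vec_mxK); rewrite linear0.
have surj (v : 'cV[H]_n) : exists w, M *m w = v.
  have /submxP[X vX] := submx_full (mxvec (real_of_cV v)) (free_g : row_full _).
  exists (cV_of_real (vec_mx X)); apply: (can_inj real_of_cVK).
  by have := congr1 vec_mx vX; rewrite mxvecK mul_rV_lin mxvecK.
have /choice[w wP] : forall j : 'I_n, exists w, M *m w = delta_mx j 0 := fun j => surj _.
pose N : 'M[H]_n := \matrix_(i, j) w j i 0.
have MN : M *m N = 1%:M.
  apply/matrixP => i j; have := congr1 (fun v : 'cV[H]_n => v i 0) (wP j).
  rewrite !mxE eqxx andbT => <-.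
  by apply: eq_bigr => k _; rewrite mxE.
exists N; split=> //; apply/matrixP => i j.
have : col j (N *m M - 1%:M) = 0.
  by apply: injM; rewrite colE mulmxA mulmxBr mulmx1 mulmxA MN mul1mx subrr mul0mx.
by move/(congr1 (fun v : 'cV[H]_n => v i 0)); rewrite !mxE => /eqP; rewrite subr_eq0 => /eqP.
Qed.

End RealificationRank.

(** * Putzer matrices *)

Section OrderedSymmetric.
Variables (R : realType) (alpha : seq (quat R)).

(** A subset of ['I_k.+1] is encoded by its trace on ['I_k] and a bit for the largest index. *)
Let ext k (p : {set 'I_k} * bool) : {set 'I_k.+1} :=
  [set i | if unlift ord_max i is Some j then j \in p.1 else p.2].

Let widen_lift k (i : 'I_k) : widen_ord (leqnSn k) i = lift ord_max i.
Proof. by apply: val_inj; rewrite /= /bump leqNgt ltn_ord. Qed.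

Let ext_widen k p (i : 'I_k) : (widen_ord (leqnSn k) i \in ext p) = (i \in p.1).
Proof.
by rewrite widen_lift inE liftK.
Qed.

Let ext_max k (p : {set 'I_k} * bool) : (ord_max \in ext p) = p.2.
Proof. by rewrite inE unlift_none. Qed.

Let ext_bij k : bijective (@ext k).
Proof.
exists (fun I : {set 'I_k.+1} =>
  ([set i | widen_ord (leqnSn k) i \in I]%SET, ord_max \in I)) => [[S b]|I].
  congr pair; last exact: ext_max.
  by apply/setP => i; rewrite inE ext_widen.
apply/setP => i; rewrite inE; case: unliftP => [j ->|->] //.
by rewrite inE widen_lift.
Qed.

Let card_ext k (p : {set 'I_k} * bool) : #|ext p| = (#|p.1| + p.2)%N.
Proof.
rewrite -sum1_card big_mkcond big_ord_recr /= ext_max; congr (_ + _)%N.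
rewrite -[RHS]sum1_card [RHS]big_mkcond; apply: eq_bigr => i _.
by rewrite ext_widen.
Qed.

(** The largest index comes last in the enumeration, so its factor lands on the right of the
    noncommutative product. *)
Let prod_ext k (p : {set 'I_k} * bool) :
  \prod_(i in ext p) alpha`_i =
  (\prod_(i in p.1) alpha`_i) * (if p.2 then alpha`_k else 1).
Proof.
rewrite big_mkcond big_ord_recr /= ext_max; congr (_ * _).
rewrite [RHS]big_mkcond; apply: eq_bigr => i _.
by rewrite ext_widen.
Qed.

Let esym_split k (j : nat) : ordered_esym alpha k.+1 j =
  \sum_(S : {set 'I_k} | (#|S| + 1)%N == j) (\prod_(i in S) alpha`_i) * alpha`_k +
  ordered_esym alpha k j.
Proof.
rewrite /ordered_esym (reindex (@ext k)); last exact: onW_bij (ext_bij k).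
rewrite big_mkcond.
rewrite -(pair_bigA _ (fun S b => if #|ext (S, b)| == j
   then \prod_(i in ext (S, b)) alpha`_i else 0)) /=.
rewrite exchange_big big_bool /=; congr (_ + _); rewrite [RHS]big_mkcond.
  by apply: eq_bigr => S _; rewrite card_ext prod_ext.
by apply: eq_bigr => S _; rewrite card_ext prod_ext addn0 mulr1.
Qed.

(** A Pascal rule, according to whether the largest index is chosen. Its factor stands on the right,
    which matches the term [P_(k-1) alpha_k] of the recursion. *)
Lemma ordered_esymS k j : ordered_esym alpha k.+1 j.+1 =
  ordered_esym alpha k j.+1 + ordered_esym alpha k j * alpha`_k.
Proof.
rewrite esym_split addrC; congr (_ + _); rewrite mulr_suml.
by apply: eq_bigl => S; rewrite addn1.
Qed.

Lemma ordered_esym0 k : ordered_esym alpha k 0 = 1.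
Proof.
rewrite /ordered_esym (big_pred1 finset.set0) => [|S]; last by rewrite cards_eq0.
by rewrite big_pred0 // => i; rewrite inE.
Qed.

Lemma ordered_esym_gt k j : (k < j)%N -> ordered_esym alpha k j = 0.
Proof.
move=> kj; apply: big_pred0 => S; apply/negbTE; rewrite neq_ltn.
by rewrite (leq_ltn_trans (max_card _)) // card_ord.
Qed.

End OrderedSymmetric.

Section PutzerMatrices.
Variables (R : realType) (n : nat) (A : 'M[quat R]_n).

Lemma putzer_mxE (alpha : seq (quat R)) k : putzer_mx A alpha k =
  \sum_(j < k.+1) (-1) ^+ j *: rscalemx (A ^+ (k - j)) (ordered_esym alpha k j).
Proof.
have AX i : A *m A ^+ i = A ^+ i.+1 by rewrite exprS.
elim: k => [|k IH]; first by rewrite big_ord1 ordered_esym0 rscalemx1 scale1r.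
rewrite /= IH [RHS]big_ord_recl /= [in RHS]ordered_esym0.
rewrite [X in _ = _ + X](eq_bigr (fun j : 'I_k.+1 =>
  (-1) ^+ j.+1 *: rscalemx (A ^+ (k - j)) (ordered_esym alpha k j.+1) -
  (-1) ^+ j *: rscalemx (A ^+ (k - j)) (ordered_esym alpha k j * alpha`_k))); last first.
  move=> j _; rewrite ordered_esymS rscalemxDr scalerDr subSS; congr (_ + _).
  by rewrite [in LHS]exprS mulN1r scaleNr.
rewrite sumrB addrA; congr (_ - _); last first.
  rewrite rscalemx_suml; apply: eq_bigr => j _.
  by rewrite rscalemxZ rscalemxA.
(* The index ranges differ by one; the surplus last term has more factors than available indices, so
   its coefficient is 0. *)
rewrite mulmx_sumr [X in _ = _ + X]big_ord_recr /= ordered_esym_gt // rscalemx0r scaler0 addr0.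
rewrite big_ord_recl /=; congr (_ + _).
  by rewrite mulmx_signr mulmx_rscalemx !subn0 ordered_esym0 AX.
apply: eq_bigr => j _; rewrite mulmx_signr mulmx_rscalemx /bump add1n AX.
by rewrite subnSK.
Qed.

Variables (m : nat) (alpha : m.-tuple (quat R)).

(** Collects the [j]-th columns of all [P_k], so that column [j] of the Putzer sum is a constant
    matrix times [phi]. *)
Definition putzer_cols (j : 'I_n) : 'M[quat R]_(n, m) :=
  \matrix_(i, k) putzer_mx A alpha k i j.

(** On column [k], the bidiagonal matrix produces [P_k alpha_(k+1) + P_(k+1)], which is [A P_k] by
    the recursion. The last column has no subdiagonal entry, and there [P_m = 0] supplies the
    missing term. *)
Lemma putzer_cols_system j : putzer_mx A alpha m = 0 ->
  putzer_cols j *m putzer_system alpha = A *m putzer_cols j.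
Proof.
move=> Pm0; apply/matrixP => i k.
have -> : (A *m putzer_cols j) i k = (A *m putzer_mx A alpha k) i j.
  by rewrite !mxE; apply: eq_bigr => l _; rewrite mxE.
have -> : A *m putzer_mx A alpha k =
    rscalemx (putzer_mx A alpha k) alpha`_k + putzer_mx A alpha k.+1.
  by rewrite addrC subrK.
set P' := putzer_mx A alpha k.+1; rewrite mxE [RHS]mxE (bigD1 k) //=; congr (_ + _).
  by rewrite !mxE eqxx (tnth_nth 0).
have [km|mk] := ltnP k.+1 m.
  rewrite (bigD1 (Ordinal km)) /=; last by rewrite -val_eqE /= gtn_eqF.
  rewrite big1 ?addr0 => [|l /andP[lk]].
    by rewrite !mxE eqxx ifF ?mulr1 // -val_eqE /= gtn_eqF.
  by rewrite -val_eqE /= => lk1; rewrite !mxE (negbTE lk) (negbTE lk1) mulr0.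
have -> : P' = 0.
  by rewrite /P'; have -> : k.+1 = m by apply/eqP; rewrite eqn_leq mk ltn_ord.
rewrite mxE big1 // => l lk; rewrite !mxE (negbTE lk) ifF ?mulr0 //.
by rewrite ltn_eqF // (leq_trans _ mk).
Qed.

Definition putzer_sum (phi : R -> 'cV[quat R]_m) (t : R) : 'M[quat R]_n :=
  \sum_(k < m) rscalemx (putzer_mx A alpha k) (phi t k 0).

Lemma col_putzer_sum phi t j : col j (putzer_sum phi t) = putzer_cols j *m phi t.
Proof.
apply/matrixP => i c; rewrite (ord1 c) !mxE summxE.
by apply: eq_bigr => k _; rewrite !mxE.
Qed.

Lemma putzer_sum_solution T phi j : putzer_mx A alpha m = 0 ->
  is_solution T (putzer_system alpha) phi ->
  is_solution T A (fun t => col j (putzer_sum phi t)).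
Proof.
move=> Pm0 phiS t kt; have /(has_delta_deriv_mxM (putzer_cols j)) := phiS t kt.
rewrite mulmxA putzer_cols_system // -mulmxA -col_putzer_sum.
by under eq_fun do rewrite -col_putzer_sum.
Qed.

Lemma putzer_sum_init phi t : putzer_mx A alpha m = 0 ->
  phi t = putzer_init R m -> putzer_sum phi t = 1%:M.
Proof.
rewrite /putzer_sum => Pm0 ->; case: m alpha Pm0 => [|m'] alpha' Pm0.
  (* For [m = 0] the hypothesis says that the identity is 0, which is the empty sum. *)
  by rewrite big_ord0 -Pm0.
rewrite (bigD1 ord0) //= mxE eqxx rscalemx1 big1 ?addr0 // => k k0.
rewrite mxE ifF ?rscalemx0r //; exact: negbTE.
Qed.

End PutzerMatrices.

(** * The state-transition matrix *)

Section StateTransition.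
Variables (R : realType) (T : set R) (n : nat) (A : 'M[quat R]_n).

Lemma qinvmxP (M N : 'M[quat R]_n) : is_invmx M N -> qinvmx M = N.
Proof.
move=> MN; apply: xget_unique => // N' [_ N'M].
by rewrite -[N']mulmx1 -MN.1 mulmxA N'M mul1mx.
Qed.

Lemma solution_mulmxr (X : R -> 'M[quat R]_n) (v : 'cV[quat R]_n) :
  (forall j, is_solution T A (fun t => col j (X t))) ->
  is_solution T A (fun t => X t *m v).
Proof.
move=> XA t kt; rewrite mulmxA; apply: has_delta_deriv_mxMr => i j.
have := XA j t kt i 0; rewrite !mxE; under eq_fun do rewrite mxE.
by under eq_bigr do rewrite mxE.
Qed.

Hypotheses (clT : closed T) (regA : regressive_mx T A).

Lemma state_transition_normalized (X : R -> 'M[quat R]_n) (s t : R) :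
  T s -> T t -> (forall j, is_solution T A (fun t => col j (X t))) ->
  X s = 1%:M -> state_transition T A t s = X t.
Proof.
move=> Ts Tt XA Xs.
(* Columnwise, [M u] and [X u *m M s] are solutions that agree at [s]. *)
have XM M : (forall j, is_solution T A (fun t => col j (M t))) ->
    forall u, T u -> M u = X u *m M s.
  move=> MA u Tu; apply/matrixP => i j.
  pose y u := col j (M u) - X u *m col j (M s).
  have yA : is_solution T A y.
    move=> v kv; rewrite /y mulmxBr; apply: has_delta_deriv_mxB; first exact: MA.
    exact: solution_mulmxr kv.
  have : y u = 0.
    by apply: (solution_unique clT regA yA Ts Tu); rewrite /y Xs mul1mx subrr.
  move/(congr1 (fun v : 'cV[quat R]_n => v i 0)); rewrite /y !mxE.
  by move/eqP; rewrite subr_eq0 => /eqP ->; apply: eq_bigr => k _; rewrite mxE.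
have fundX : fundamental_matrix T A X.
  split=> // a a0 i; have := congr1 (fun v : 'cV[quat R]_n => v i 0) (a0 s Ts).
  rewrite summxE mxE (bigD1 i) //= big1 ?addr0; last first.
    by move=> j ji; rewrite !mxE Xs mxE eq_sym (negbTE ji) mul0r.
  by rewrite !mxE Xs mxE eqxx mul1r.
have XtP M : fundamental_matrix T A M -> X t = M t *m qinvmx (M s).
  (* A kernel vector of [M s] satisfies [M u *m v = 0] at every [u] of [T], a right linear relation
     among the columns, so it is 0. *)
  move=> [MA Mind]; have [N MN] : exists N, is_invmx (M s) N.
    apply: injective_mulmx_invertible => v Msv0.
    apply/matrixP => i c; rewrite (ord1 c) [RHS]mxE.
    apply: (Mind (fun i => v i 0)) => u Tu.
    transitivity (M u *m v); last by rewrite (XM _ _ MA u Tu) -mulmxA Msv0 mulmx0.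
    apply/matrixP => k c'; rewrite (ord1 c') summxE mxE.
    by apply: eq_bigr => j _; rewrite !mxE.
  by rewrite (qinvmxP MN) (XM _ _ MA t Tt) -mulmxA MN.1 mulmx1.
apply: xget_unique; first by split; [exists X|].
(* Testing against the fundamental matrix [X] alone already determines the value. *)
by move=> Psi [_ PsiP]; rewrite (PsiP X fundX) -(XtP X fundX).
Qed.

End StateTransition.

Theorem theorem5p5 (R : realType) (T : set R) (hT : time_scale T)
    (n m : nat) (A : 'M[quat R]_n) (hA : regressive_mx T A)
    (t0 : R) (ht0 : T t0)
    (alpha : m.-tuple (quat R))
    (halpha : forall i : 'I_m, regressive T (tnth alpha i))
    (hP : putzer_mx A alpha m = 0) :
  (forall k : nat, (1 <= k <= m)%N ->
     putzer_mx A alpha k =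
       A ^+ k + \sum_(1 <= j < k.+1)
                  (-1) ^+ j *: rscalemx (A ^+ (k - j)) (ordered_esym alpha k j))
  /\
  (forall phi : R -> 'cV[quat R]_m,
     is_solution T (putzer_system alpha) phi -> phi t0 = putzer_init R m ->
     forall t : R, T t ->
       state_transition T A t t0 =
         \sum_(k < m) rscalemx (putzer_mx A alpha k) (phi t k 0)).
Proof.
split=> [k _|phi phiS phi0 t Tt].
  rewrite putzer_mxE big_ord_recl /= scale1r ordered_esym0 rscalemx1 subn0.
  by rewrite big_add1 big_mkord.
apply: (state_transition_normalized (X := @putzer_sum R n A m alpha phi) hT.2 hA ht0 Tt) => [j|].
  exact: putzer_sum_solution.
exact: putzer_sum_init.
Qed.
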